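(* Let $f$, $g$, $h$ and $k$ be four self-maps of a metric space $(\mathcal{X},d)$. Suppose that each of the pairs $(f,h)$ and $(g,k)$ is subcompatible and reciprocally continuous. Then (a) $f$ and $h$ have a coincidence point; (b) $g$ and $k$ have a coincidence point. Further, let $\varphi:(\mathbb{R}^{+})^{6}\rightarrow\mathbb{R}$ be a continuous function such that $\varphi(u,u,0,0,u,u)>0$ for all $u>0$, and suppose that for all $x,y\in\mathcal{X}$ $$\varphi\big(d(fx,gy),d(hx,ky),d(fx,hx),d(gy,ky),d(hx,gy),d(ky,fx)\big)\leq 0.$$ Then $f$, $g$, $h$ and $k$ have a unique common fixed point.
   Context: $\mathbb{R}^{+}=[0,\infty)$; $fx$ denotes $f(x)$ and $fgx$ denotes $f(g(x))$. Let $f,g$ be self-maps of a metric space $(\mathcal{X},d)$. - $f$ and $g$ are subcompatible if there exists a sequence $(x_n)$ in $\mathcal{X}$ such that $\lim_{n\to\infty}fx_n=\lim_{n\to\infty}gx_n=t$ for some $t\in\mathcal{X}$ and $\lim_{n\to\infty}d(fgx_n,gfx_n)=0$. - $f$ and $g$ are reciprocally continuous if $\lim_{n\to\infty}fgx_n=ft$ and $\lim_{n\to\infty}gfx_n=gt$ whenever $(x_n)\subset\mathcal{X}$ is a sequence such that $\lim_{n\to\infty}fx_n=\lim_{n\to\infty}gx_n=t\in\mathcal{X}$. - A coincidence point of $f$ and $g$ is a point $x$ with $fx=gx$; a common fixed point of a family of self-maps is a point fixed by every map in the family. *)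

(* Defs.v *)
From HB Require Import structures.
From mathcomp Require Import all_boot all_order all_algebra.
From mathcomp Require Import all_classical all_reals all_analysis.

Set Implicit Arguments.
Unset Strict Implicit.
Unset Printing Implicit Defensive.

Import Order.TTheory GRing.Theory Num.Theory.
Import numFieldNormedType.Exports.

Local Open Scope classical_set_scope.
Local Open Scope ring_scope.

Definition subcompatible (R : realType) (X : metricType R) (f g : X -> X) : Prop :=
  exists (x : nat -> X) (t : X),
    [/\ f (x n) @[n --> \oo] --> t,
        g (x n) @[n --> \oo] --> t
      & mdist (f (g (x n))) (g (f (x n))) @[n --> \oo] --> (0 : R)].

Definition reciprocally_continuous (R : realType) (X : metricType R)
    (f g : X -> X) : Prop :=
  forall (x : nat -> X) (t : X),
    f (x n) @[n --> \oo] --> t ->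
    g (x n) @[n --> \oo] --> t ->
    f (g (x n)) @[n --> \oo] --> f t /\ g (f (x n)) @[n --> \oo] --> g t.

Definition coincidence_point (X : Type) (f g : X -> X) (x : X) : Prop :=
  f x = g x.

Definition common_fixed_point (X : Type) (F : set (X -> X)) (x : X) : Prop :=
  forall f, F f -> f x = x.

Definition Rplus (R : realType) : set R := [set u | 0 <= u].

(* A continuous map on [0, oo)^6 is encoded as a total map on R^6 that is
   continuous for the subspace topology of this set; its values elsewhere
   are junk. *)
Definition Rplus6 (R : realType) : set (R * R * R * R * R * R) :=
  @Rplus R `*` @Rplus R `*` @Rplus R `*` @Rplus R `*` @Rplus R `*` @Rplus R.

(* Main.v *)
Require Import Defs.
From HB Require Import structures.
From mathcomp Require Import all_boot all_order all_algebra.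
From mathcomp Require Import all_classical all_reals all_analysis.

Set Implicit Arguments.
Unset Strict Implicit.
Unset Printing Implicit Defensive.

Import Order.TTheory GRing.Theory Num.Theory.
Import numFieldNormedType.Exports.

Local Open Scope classical_set_scope.
Local Open Scope ring_scope.

(** If [f x_n, h x_n --> t], subcompatibility and reciprocal continuity force
    [f t = h t], and likewise [g s = k s] for the limit [s] of the other pair.
    Whenever [a_n, b_n --> p] and [c_n, e_n --> q] satisfy the implicit
    relation, passing to the limit gives
    [phi (d, d, 0, 0, d, d) <= 0] with [d = mdist p q], hence [p = q].  This one
    principle, applied to the two sequences, to one of them against a constant
    sequence and to two constant sequences, yields successively
    [t = s], [f t = t], [g t = t] and uniqueness. *)

(** Two triangle inequalities bound one signed difference, and symmetry of the metric gives the
    other; this yields the joint continuity of [mdist]. *)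
Lemma ler_dist_mdist (R : realType) (X : metricType R) (p q u v : X) :
  `|mdist p q - mdist u v| <= mdist p u + mdist q v.
Proof.
have tri (a b c e : X) : mdist a b - mdist c e <= mdist a c + mdist b e.
  rewrite lerBlDr (le_trans (metric_triangle a c b))// -addrA lerD2l.
  by rewrite (metric_sym b) addrC metric_triangle.
rewrite ler_norml tri andbT lerNl opprB.
by rewrite (metric_sym p u) (metric_sym q v) tri.
Qed.

Lemma cvg_mdist (R : realType) (X : metricType R) (T : Type)
    {F : set_system T} {FF : Filter F} (u v : T -> X) (p q : X) :
  u @ F --> p -> v @ F --> q ->
  mdist (u n) (v n) @[n --> F] --> mdist p q.
Proof.
move=> up vq; apply/cvgrPdist_le => e e0.
have e20 : 0 < e / 2 by rewrite divr_gt0.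
have Hu := @metricType_numDomainType.cvgr_dist_le _ _ _ F FF _ _ up _ e20.
have Hv := @metricType_numDomainType.cvgr_dist_le _ _ _ F FF _ _ vq _ e20.
apply: (@filterS2 _ F FF _ _ _ _ Hu Hv) => n un vn.
by rewrite (le_trans (ler_dist_mdist _ _ _ _))// (splitr e) lerD.
Qed.

(** The distances between [f (h (x n))] and [h (f (x n))] tend both to [mdist (f t) (h t)] and to
    [0]. The sequence is returned along with [t] because the fixed-point argument uses it again. *)
Lemma subcompatible_coincidence (R : realType) (X : metricType R)
    (f h : X -> X) :
  subcompatible f h -> reciprocally_continuous f h ->
  exists (x : nat -> X) (t : X),
    [/\ f (x n) @[n --> \oo] --> t, h (x n) @[n --> \oo] --> t
      & coincidence_point f h t].
Proof.
move=> [x [t [fx hx d0]]] rc; exists x, t; split=> //.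
have [fh hf] := rc x t fx hx.
apply: mdist_positivity.
exact: (cvg_unique (@norm_hausdorff _ R^o) (cvg_mdist fh hf) d0).
Qed.

(** The sequences [a], [b], [c], [e] stand for the images under [f], [h], [g], [k] of two sequences
    of points. *)
Lemma implicit_relation_cvg_eq (R : realType) (X : metricType R)
    (phi : R * R * R * R * R * R -> R) (a b c e : nat -> X) (p q : X) :
  {within @Rplus6 R, continuous phi} ->
  (forall u : R, 0 < u -> 0 < phi (u, u, 0, 0, u, u)) ->
  (forall n, phi (mdist (a n) (c n), mdist (b n) (e n), mdist (a n) (b n),
                  mdist (c n) (e n), mdist (b n) (c n),
                  mdist (e n) (a n)) <= 0) ->
  a n @[n --> \oo] --> p -> b n @[n --> \oo] --> p ->
  c n @[n --> \oo] --> q -> e n @[n --> \oo] --> q -> p = q.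
Proof.
move=> /subspace_continuousP cphi phi_gt0 phi_le0 ap bp cq eq.
apply/eqP/negPn/negP => pq.
pose w n := (mdist (a n) (c n), mdist (b n) (e n), mdist (a n) (b n),
             mdist (c n) (e n), mdist (b n) (c n), mdist (e n) (a n)).
pose w0 := (mdist p q, mdist p q, mdist p p, mdist q q, mdist p q, mdist q p).
have w_ge0 n : @Rplus6 R (w n) by do !split; exact: mdist_ge0.
have w0_ge0 : @Rplus6 R w0 by do !split; exact: mdist_ge0.
have ww0 : w n @[n --> \oo] --> w0.
  by repeat apply: (@cvg_pair _ _ _ _ (nbhs _) (nbhs _)); exact: cvg_mdist.
have phiw : phi (w n) @[n --> \oo] --> phi w0.
  (* Continuity of [phi] at [w0] holds only within [Rplus6]; this suffices since every [w n] lies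
     there. *)
  move=> A /(cphi _ w0_ge0) /ww0 wA.
  by apply: (@filterS _ \oo _ _ _ _ wA) => n /= /(_ (w_ge0 n)).
have : phi w0 <= 0.
  by apply: (cvgr_to_le phiw); apply: nearW => n; exact: phi_le0.
rewrite /w0 !mdistxx (metric_sym q p) leNgt => /negP; apply.
by apply: phi_gt0; rewrite mdist_gt0.
Qed.

Theorem mainTheorem1 (R : realType) (X : metricType R) (f g h k : X -> X)
    (fh_sub : subcompatible f h) (fh_rc : reciprocally_continuous f h)
    (gk_sub : subcompatible g k) (gk_rc : reciprocally_continuous g k) :
  [/\ exists x : X, coincidence_point f h x,
      exists x : X, coincidence_point g k x
    & forall phi : R * R * R * R * R * R -> R,
        {within @Rplus6 R, continuous phi} ->
        (forall u : R, 0 < u -> 0 < phi (u, u, 0, 0, u, u)) ->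
        (forall x y : X,
           phi (mdist (f x) (g y), mdist (h x) (k y), mdist (f x) (h x),
                mdist (g y) (k y), mdist (h x) (g y), mdist (k y) (f x)) <= 0) ->
        exists! z : X, common_fixed_point [set f; g; h; k] z].
Proof.
have [x [t [fx hx fht]]] := subcompatible_coincidence fh_sub fh_rc.
have [y [s [gy ky gks]]] := subcompatible_coincidence gk_sub gk_rc.
split; [by exists t | by exists s |] => phi cphi phi_gt0 phi_le0.
have limit_eq (u v : nat -> X) (p q : X) :
    f (u n) @[n --> \oo] --> p -> h (u n) @[n --> \oo] --> p ->
    g (v n) @[n --> \oo] --> q -> k (v n) @[n --> \oo] --> q -> p = q.
  exact: implicit_relation_cvg_eq cphi phi_gt0 (fun n => phi_le0 (u n) (v n)).
have cvgc (p : X) : p @[_ --> \oo] --> p by exact: cvg_cst.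
have hft : h t @[_ --> \oo] --> f t by rewrite fht.
have kgs : k s @[_ --> \oo] --> g s by rewrite gks.
have ts : t = s by exact: limit_eq fx hx gy ky.
(* The constant sequence [t] has both images equal to [f t]; compared with [y], it gives
   [f t = s]. *)
have ft : f t = t.
  by rewrite [RHS]ts; exact: limit_eq (fun=> t) y _ _ (cvgc _) hft gy ky.
(* Symmetrically, [x] against the constant sequence [s] gives [t = g s]. *)
have gt : g t = t.
  by rewrite ts -[RHS]ts; exact/esym/(limit_eq x (fun=> s) _ _ fx hx (cvgc _) kgs).
have ht : h t = t by rewrite -fht.
have kt : k t = t by rewrite [in k t]ts -gks -ts.
exists t; split; first by move=> _ [[[->|->]|->]|->].
move=> z zfix.
have [fz gz hz kz] : [/\ f z = z, g z = z, h z = z & k z = z].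
  by split; apply: zfix; rewrite /=; tauto.
(* Here [t] is taken as a fixed point of [f] and [h], and [z] as one of [g] and [k]. *)
by apply: (limit_eq (fun=> t) (fun=> z)); rewrite ?ft ?ht ?gz ?kz.
Qed.
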